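(* Consider a solution on $[0,T]$ of the constrained joint dynamics $$\frac{dy}{dt}=-\alpha\,P_{\mathcal{Q}}\bigl(\delta^T\delta\,x\bigr),\qquad \frac{d\delta}{dt}=-\beta\,\Pi_{\mathcal{M}}\bigl(\delta\,x\,x^T\bigr),\qquad x=\tilde u+\tilde y,\quad \alpha,\beta>0,$$ with initial condition $(y_0,\delta_0)$, $x_0=\tilde u+\tilde y_0$, $\delta_0x_0\neq0$. Assume $\sup_{[0,T]}\|x(t)\|\le B_x$ with $B_x>0$, $\sup_{[0,T]}\|\delta(t)\|_F\le B_\delta$ with $B_\delta>0$, and $\lambda_{\mathrm{eff}}>0$, $\mu_{\mathrm{eff}}>0$, where $$\lambda_{\mathrm{eff}}=\inf_{t\in[0,T]}\frac{\|P_{\mathcal{Q}}(L_{\mathcal{F}}(\delta(t))x(t))\|^2}{\|\delta(t)x(t)\|^2},\qquad \mu_{\mathrm{eff}}=\inf_{t\in[0,T]}\frac{\|\Pi_{\mathcal{M}}(\delta(t)x(t)x(t)^T)\|_F^2}{\|\delta(t)x(t)\|^2}.$$ Fix $\varepsilon>0$ and define $$\rho_-:=\frac{\varepsilon\lambda_{\mathrm{eff}}}{B_x\|\delta_0x_0\|},\qquad \rho_+:=\frac{B_\delta\|\delta_0x_0\|}{\varepsilon\mu_{\mathrm{eff}}}.$$ 1. If $\beta/\alpha\le\rho_-$, then $\|\delta(T)-\delta_0\|_F\le\varepsilon$. 2. If $\beta/\alpha\ge\rho_+$, then $\|x(T)-x(0)\|\le\varepsilon$. 3. If $\varepsilon^2<B_xB_\delta\|\delta_0x_0\|^2/(\lambda_{\mathrm{eff}}\mu_{\mathrm{eff}})$,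 then $\rho_-<\rho_+$. In the intermediate regime $\rho_-<\beta/\alpha<\rho_+$, the upper bounds $\frac{\beta B_x\|\delta_0x_0\|}{\alpha\lambda_{\mathrm{eff}}}$ on the structural displacement and $\frac{\alpha B_\delta\|\delta_0x_0\|}{\beta\mu_{\mathrm{eff}}}$ on the opinion displacement both exceed $\varepsilon$ (so that these bounds allow, but do not force, both variables to change by more than $\varepsilon$).
   Context: Let $G=(V,E)$ be a finite connected graph. A discourse sheaf $\mathcal{F}$ on $G$ assigns finite-dimensional real inner product spaces $\mathcal{F}(v)$, $\mathcal{F}(e)$ to vertices and edges and linear restriction maps $\mathcal{F}_{v\unlhd e}:\mathcal{F}(v)\to\mathcal{F}(e)$ to incidences $v\in e$ (written $v\unlhd e$). $C^0=\bigoplus_v\mathcal{F}(v)$, $C^1=\bigoplus_e\mathcal{F}(e)$ with direct-sum inner products. For a fixed edge orientation the coboundary is $(\delta x)_e=\mathcal{F}_{v\unlhd e}(x_v)-\mathcal{F}_{u\unlhd e}(x_u)$ for $e=u\to v$. In the joint dynamics the stalks are fixed, but the restriction maps, encoded by the blocks of $\delta$ (the block from $\mathcal{F}(v)$ to $\mathcal{F}(e)$ is $\pm\mathcal{F}_{v\unlhd e}$, and blocks for non-incident pairs are zero), vary with time. $L_{\mathcal{F}}(\delta)=\delta^T\delta$, and $\|\cdot\|_F$ is the Frobenius norm. Stubborn opinions: $U\subseteq V$ is the set of stubborn vertices; each stalk splits orthogonally as $\mathcal{F}(v)=S_v\oplus T_v$ with $T_v=S_v^\perp$ and $S_v=\{0\}$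 for $v\notin U$. $C^0(S)=\bigoplus_vS_v$, $C^0(\mathcal{Q})=\bigoplus_vT_v$; $P_{\mathcal{Q}}:C^0\to C^0(\mathcal{Q})$ is the orthogonal projection. $u\in C^0(S)$ is fixed (constant in time), $y(t)\in C^0(\mathcal{Q})$ evolves, and $\tilde u,\tilde y$ denote their inclusions in $C^0$. Adapting incidences: $\mathcal{I}\subseteq\{(v,e):v\unlhd e\}$. $\mathcal{M}$ is the space of linear maps $C^0\to C^1$ whose block from $\mathcal{F}(v)$ to $\mathcal{F}(e)$ vanishes unless $(v,e)\in\mathcal{I}$; $\Pi_{\mathcal{M}}$ is the orthogonal projection onto $\mathcal{M}$ in the Frobenius inner product. $\delta xx^T$ denotes the map $z\mapsto\langle x,z\rangle\,\delta x$. The infima are taken over those $t$ with $\delta(t)x(t)\neq0$. Structural displacement means $\|\delta(T)-\delta_0\|_F$; opinion displacement means $\|x(T)-x(0)\|$. *)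

(* Defs.v *)
From HB Require Import structures.
From mathcomp Require Import all_boot all_order all_algebra.
From mathcomp Require Import sesquilinear.
From mathcomp Require Import all_classical all_reals all_analysis.

Set Implicit Arguments.
Unset Strict Implicit.
Unset Printing Implicit Defensive.

Import Order.TTheory GRing.Theory Num.Theory.
Import numFieldNormedType.Exports.

Local Open Scope classical_set_scope.
Local Open Scope ring_scope.

Record ipspace (R : realType) := IPSpace {
  ip_vect :> vectType R;
  ip_dot : {dot ip_vect for idfun} }.

Definition inner (R : realType) (V : ipspace R) (x y : V) : R := ip_dot V x y.

Notation "''[' x , y ]" := (inner x%R y%R) : ring_scope.

Definition ipnorm (R : realType) (V : ipspace R) (x : V) : R :=
  Num.sqrt '[x, x].

Section InnerTheory.
Variables (R : realType) (V : ipspace R).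
Implicit Types (x y z : V) (U : {vspace V}).

Lemma innerC x y : '[x, y] = '[y, x].
Proof. by rewrite /inner hermC expr0 mul1r. Qed.

Lemma inner_suml I r (P : pred I) (E : I -> V) z :
  '[\sum_(i <- r | P i) E i, z] = \sum_(i <- r | P i) '[E i, z].
Proof. exact: linear_sumlz. Qed.

Lemma inner_sumr I r (P : pred I) (E : I -> V) z :
  '[z, \sum_(i <- r | P i) E i] = \sum_(i <- r | P i) '[z, E i].
Proof. exact: linear_sumr. Qed.

Lemma innerDl x y z : '[x + y, z] = '[x, z] + '[y, z].
Proof. exact: linearDl. Qed.

Lemma innerDr x y z : '[z, x + y] = '[z, x] + '[z, y].
Proof. exact: linearDr. Qed.

Lemma innerBl x y z : '[x - y, z] = '[x, z] - '[y, z].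
Proof. exact: linearBl. Qed.

Lemma innerZl a x z : '[a *: x, z] = a * '[x, z].
Proof. exact: linearZl_LR. Qed.

Lemma innerZr a x z : '[z, a *: x] = a * '[z, x].
Proof. by rewrite innerC innerZl innerC. Qed.

Lemma inner_gt0 x : x != 0 -> 0 < '[x, x].
Proof. exact: neq0_dnorm_gt0. Qed.

Lemma inner0r x : '[x, 0] = 0.
Proof. exact: linear0r. Qed.

Lemma inner_ge0 x : 0 <= '[x, x].
Proof.
by have [->|/inner_gt0/ltW//] := eqVneq x 0; rewrite inner0r.
Qed.

Lemma innerI x y : (forall z, '[x, z] = '[y, z]) -> x = y.
Proof.
move=> xy; apply/eqP; rewrite -subr_eq0; apply/negPn/negP => /inner_gt0.
by rewrite innerBl xy subrr ltxx.
Qed.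

End InnerTheory.

Section OrthonormalBasis.
Variables (R : realType) (V : ipspace R).
Implicit Types (x y z : V) (U : {vspace V}).

Definition onb n (e : n.-tuple V) U :=
  basis_of U e /\ forall i j : 'I_n, '[e`_i, e`_j] = (i == j)%:R.

Lemma onb_exists U : exists e : (\dim U).-tuple V, onb e U.
Proof.
suff H n : (n <= \dim U)%N -> exists e : n.-tuple V,
    (forall i : 'I_n, e`_i \in U) /\
    (forall i j : 'I_n, '[e`_i, e`_j] = (i == j)%:R).
  have [e [eU eO]] := H _ (leqnn _).
  exists e; split => //; rewrite basisEdim size_tuple leqnn andbT.
  have fe : free e.
    apply/freeP => k k0 i.
    move/(congr1 (fun x => '[x, e`_i])): k0.
    rewrite inner_suml (bigD1 i) //= innerZl eO eqxx mulr1 big1 ?addr0.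
      by rewrite innerC inner0r.
    by move=> j ji; rewrite innerZl eO (negbTE ji) mulr0.
  have eU' : (<<e>> <= U)%VS.
    by apply/span_subvP => x /tnthP[i ->]; rewrite (tnth_nth 0).
  by rewrite -(geq_leqif (dimv_leqif_sup eU')) (eqnP fe) size_tuple.
elim: n => [_|n IH lt_n].
  by exists [tuple]; split => [[]|[]].
have [e [eU eO]] := IH (ltnW lt_n).
have [w wU we] : exists2 w, w \in U & w \notin <<e>>%VS.
  apply/subvPn; apply: contraL lt_n => /dimvS le_U.
  by rewrite -leqNgt (leq_trans le_U) // (leq_trans (dim_span _)) ?size_tuple.
pose z := w - \sum_(i < n) '[e`_i, w] *: e`_i.
have z0 : z != 0.
  apply: contraNneq we => /eqP; rewrite subr_eq0 => /eqP ->.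
  apply: memv_suml => i _; apply: memvZ; apply: memv_span.
  by rewrite mem_nth // size_tuple.
have zU : z \in U.
  by apply: memvB => //; apply: memv_suml => i _; apply: memvZ.
have ez (i : 'I_n) : '[e`_i, z] = 0.
  rewrite innerC innerBl inner_suml (bigD1 i) //= innerZl eO eqxx mulr1 big1.
    by rewrite addr0 innerC subrr.
  by move=> j ji; rewrite innerZl eO (negbTE ji) mulr0.
have nz0 : ipnorm z != 0 by rewrite sqrtr_eq0 -ltNge inner_gt0.
exists [tuple of (ipnorm z)^-1 *: z :: e]; split => [i|i j].
  by case: (unliftP ord0 i) => [j ->|->] /=; [exact: eU|exact: memvZ].
have ezn (k : 'I_n) : '[(ipnorm z)^-1 *: z, e`_k] = 0.
  by rewrite innerZl innerC ez mulr0.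
case: (unliftP ord0 i) (unliftP ord0 j) => [i' ->|->] [j' ->|->] /=.
- by rewrite eO (inj_eq lift_inj).
- by rewrite innerC ezn.
- by rewrite ezn.
- rewrite ?eqxx innerZl innerZr -[inner z z]sqr_sqrtr ?inner_ge0 //.
  by rewrite -/(ipnorm z) expr2 mulKf // mulVf ?mulr1n.
Qed.

Lemma onb_coord n (e : n.-tuple V) U : onb e U ->
  {in U, forall x i, coord e i x = '[e`_i, x]}.
Proof.
move=> [eb eO] x /(coord_basis eb) {2}-> i.
rewrite inner_sumr (bigD1 i) //= innerZr eO eqxx mulr1 big1 ?addr0 //.
by move=> j ji; rewrite innerZr eO eq_sym (negbTE ji) mulr0.
Qed.

Lemma onb_expand n (e : n.-tuple V) U x : onb e U -> x \in U ->
  x = \sum_(i < n) '[e`_i, x] *: e`_i.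
Proof.
move=> eU xU; rewrite {1}(coord_basis eU.1 xU).
by apply: eq_bigr => i _; rewrite (onb_coord eU).
Qed.

End OrthonormalBasis.

Section Adjoint.
Variables (R : realType) (V W : ipspace R).
Implicit Types f : 'Hom(V, W).

Definition adj f : 'Hom(W, V) :=
  xget 0 [set g : 'Hom(W, V) | forall x y, '[f x, y] = '[x, g y]].

Lemma adjP f x y : '[f x, y] = '[x, adj f y].
Proof.
rewrite /adj; case: xgetP => [g _ -> //|/= H].
have [e eO] := onb_exists (fullv : {vspace V}).
pose h y := \sum_(i < \dim (fullv : {vspace V})) '[f e`_i, y] *: e`_i.
have hlin : linear h.
  move=> a u v; rewrite /h scaler_sumr -big_split /=; apply: eq_bigr => i _.
  by rewrite innerDr innerZr scalerDl scalerA.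
pose hL := GRing.isLinear.Build _ _ _ _ h hlin.
pose hh : {linear _ -> _} := HB.pack h hL.
case: (H (linfun hh)) => {x y}x y; rewrite lfunE /= /h inner_sumr.
rewrite {1}(onb_expand eO (memvf x)) linear_sum inner_suml.
apply: eq_bigr => i _.
by rewrite linearZ /= innerZl innerZr innerC mulrC [inner x _]innerC innerC.
Qed.

End Adjoint.

Definition lftrace (R : realType) (V : vectType R) (f : 'End(V)) : R :=
  \sum_(i < \dim (fullv : {vspace V}))
    coord (vbasis fullv) i (f (vbasis (fullv : {vspace V}))`_i).

Lemma lftrace_basis (R : realType) (V : vectType R) (f : 'End(V)) n
    (e : n.-tuple V) : basis_of fullv e ->
  lftrace f = \sum_(i < n) coord e i (f e`_i).
Proof.
move=> eb; rewrite /lftrace.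
pose b := vbasis (fullv : {vspace V}).
have bb : basis_of fullv b := vbasisP _.
transitivity (\sum_(i < \dim (fullv : {vspace V})) \sum_(j < n)
    coord e j b`_i * coord b i (f e`_j)).
  apply: eq_bigr => i _.
  rewrite {1}(coord_basis eb (memvf b`_i)) !linear_sum.
  by apply: eq_bigr => j _; rewrite !linearZ.
rewrite exchange_big /=; apply: eq_bigr => j _.
rewrite [in RHS](coord_basis bb (memvf (f e`_j))) linear_sum.
by apply: eq_bigr => i _; rewrite linearZ mulrC.
Qed.

Section Frobenius.
Variables (R : realType) (V W : ipspace R).
Implicit Types A B : 'Hom(V, W).

Definition frob A B : R := lftrace (adj A \o B)%VF.

Lemma frobE n (e : n.-tuple V) A B : onb e fullv ->
  frob A B = \sum_(i < n) '[A e`_i, B e`_i].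
Proof.
move=> eO; rewrite /frob (lftrace_basis _ eO.1); apply: eq_bigr => i _.
by rewrite (onb_coord eO) ?memvf // comp_lfunE adjP.
Qed.

Fact frob_bilinear : bilinear_for
  (GRing.Scale.Law.clone _ _ *%R _) (GRing.Scale.Law.clone _ _ (idfun \; *%R) _)
  frob.
Proof.
have [e eO] := onb_exists (fullv : {vspace V}).
split=> [B a A A'|A a B B'] /=; rewrite !(frobE _ _ eO) mulr_sumr -big_split /=;
  apply: eq_bigr => i _; rewrite add_lfunE scale_lfunE.
- by rewrite innerDl innerZl.
- by rewrite innerDr innerZr.
Qed.

HB.instance Definition _ :=
  @bilinear_isBilinear.Build R 'Hom(V, W) 'Hom(V, W) R
    (GRing.Scale.Law.clone _ _ *%R _)
    (GRing.Scale.Law.clone _ _ (idfun \; *%R) _) frob frob_bilinear.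

Fact frob_sym A B : frob A B = (-1) ^+ false * idfun (frob B A).
Proof.
have [e eO] := onb_exists (fullv : {vspace V}).
rewrite expr0 mul1r /= !(frobE _ _ eO); apply: eq_bigr => i _.
by rewrite innerC.
Qed.

HB.instance Definition _ :=
  @isHermitianSesquilinear.Build R 'Hom(V, W) false idfun frob frob_sym.

Fact frob_gt0 A : A != 0 -> 0 < frob A A.
Proof.
have [e eO] := onb_exists (fullv : {vspace V}).
move=> A0; rewrite lt_neqAle (frobE _ _ eO) sumr_ge0 ?andbT; last first.
  by move=> i _; exact: inner_ge0.
apply: contraNneq A0 => /esym/eqP; rewrite psumr_eq0 => [/allP H|i _]; last first.
  exact: inner_ge0.
apply/eqP/lfunP => x; rewrite lfunE /= (coord_basis eO.1 (memvf x)) linear_sum.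
rewrite big1 // => i _; rewrite linearZ /=.
have [->|/inner_gt0 H0] := eqVneq (A e`_i) 0; first by rewrite scaler0.
by have := H i (mem_index_enum i); rewrite (gt_eqF H0).
Qed.

HB.instance Definition _ :=
  @isDotProduct.Build R 'Hom(V, W) frob frob_gt0.

(* 'Hom(V, W) with the Frobenius inner product tr(A^T B). *)
Definition frob_ipspace : ipspace R := @IPSpace R 'Hom(V, W) frob.

Definition frobnorm (A : 'Hom(V, W)) : R := @ipnorm R frob_ipspace A.

(* The map z |-> (x, z) w, i.e. w x^T in matrix notation. *)
Definition outer (w : W) (x : V) : 'Hom(V, W) :=
  linfun (fun z : V => '[x, z] *: w).

Lemma outerE w x z : outer w x z = '[x, z] *: w.
Proof.
pose h z := '[x, z] *: w.
have hlin : linear h.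
  by move=> a u v; rewrite /h innerDr innerZr scalerDl scalerA.
pose hL := GRing.isLinear.Build _ _ _ _ h hlin.
pose hh : {linear _ -> _} := HB.pack h hL.
exact: (lfunE hh).
Qed.

End Frobenius.

Section OrthoProj.
Variables (R : realType) (V : ipspace R).
Implicit Types U : {vspace V}.

Definition orthocomp U : {vspace V} := orthov (ip_dot V) U.

Definition orthoproj U : 'End(V) := daddv_pi U (orthocomp U).

Lemma orthocompP U x :
  reflect {in U, forall y, '[x, y] = 0} (x \in orthocomp U).
Proof. exact: mem_orthovP. Qed.

Lemma orthoprojP U x :
  orthoproj U x \in U /\ x - orthoproj U x \in orthocomp U.
Proof.
have cap0 : (U :&: orthocomp U = 0)%VS.
  apply/eqP; rewrite -subv0; apply/subvP => y.
  rewrite memv_cap => /andP[yU /orthocompP yO]; rewrite memv0.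
  by apply/negPn/negP => /inner_gt0; rewrite yO ?ltxx.
have xD : x \in (U + orthocomp U)%VS.
  have [e eO] := onb_exists U.
  pose p := \sum_(i < \dim U) '[e`_i, x] *: e`_i.
  have eU (i : 'I_(\dim U)) : e`_i \in U.
    by apply: (basis_mem eO.1); rewrite mem_nth // size_tuple.
  apply/memv_addP; exists p.
    by apply: memv_suml => i _; apply: memvZ.
  exists (x - p); last by rewrite addrC subrK.
  apply/orthocompP => y /(coord_basis eO.1) ->.
  rewrite inner_sumr big1 // => i _; rewrite innerZr innerBl /p inner_suml.
  rewrite (bigD1 i) //= innerZl eO.2 eqxx mulr1 big1 => [|j ji].
    by rewrite addr0 innerC subrr mulr0.
  by rewrite innerZl eO.2 (negbTE ji) mulr0.
split; first exact: memv_pi.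
rewrite -{1}(daddv_pi_add cap0 xD) addrAC subrr add0r; exact: memv_pi.
Qed.

End OrthoProj.

Definition frobproj (R : realType) (V W : ipspace R)
    (M : {vspace 'Hom(V, W)}) : 'Hom(V, W) -> 'Hom(V, W) :=
  @orthoproj R (frob_ipspace V W) M.

Import VectorInternalTheory.

Fact v2r_linear (K : nzRingType) (vT : vectType K) : linear (@v2r K vT).
Proof. by move=> a u w; rewrite linearP. Qed.

Section DirectSum.
Variables (R : realType) (I : finType) (F : I -> ipspace R).

Definition dsum_sort : Type := {dffun forall i, F i}.

HB.instance Definition _ := Choice.on dsum_sort.

Implicit Types x y z : dsum_sort.

Let dsum0 : dsum_sort := [ffun i => 0 : F i].
Let dsumN x : dsum_sort := [ffun i => - x i : F i].
Let dsumD x y : dsum_sort := [ffun i => x i + y i : F i].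
Let dsumZ (a : R) x : dsum_sort := [ffun i => a *: x i : F i].

Fact dsum_addA : associative dsumD.
Proof. by move=> x y z; apply/ffunP => i; rewrite !ffunE addrA. Qed.
Fact dsum_addC : commutative dsumD.
Proof. by move=> x y; apply/ffunP => i; rewrite !ffunE addrC. Qed.
Fact dsum_add0 : left_id dsum0 dsumD.
Proof. by move=> x; apply/ffunP => i; rewrite !ffunE add0r. Qed.
Fact dsum_addN : left_inverse dsum0 dsumN dsumD.
Proof. by move=> x; apply/ffunP => i; rewrite !ffunE addNr. Qed.

HB.instance Definition _ :=
  GRing.isZmodule.Build dsum_sort dsum_addA dsum_addC dsum_add0 dsum_addN.

Fact dsum_scaleA a b x : dsumZ a (dsumZ b x) = dsumZ (a * b) x.
Proof. by apply/ffunP => i; rewrite !ffunE scalerA. Qed.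
Fact dsum_scale1 : left_id 1 dsumZ.
Proof. by move=> x; apply/ffunP => i; rewrite !ffunE scale1r. Qed.
Fact dsum_scaleDr : right_distributive dsumZ +%R.
Proof. by move=> a x y; apply/ffunP => i; rewrite !ffunE scalerDr. Qed.
Fact dsum_scaleDl x : {morph dsumZ^~ x : a b / a + b}.
Proof. by move=> a b; apply/ffunP => i; rewrite !ffunE scalerDl. Qed.

HB.instance Definition _ := GRing.Zmodule_isLmodule.Build R dsum_sort
  dsum_scaleA dsum_scale1 dsum_scaleDr dsum_scaleDl.

Lemma dsumDE x y i : (x + y) i = x i + y i.
Proof. exact: ffunE. Qed.
Lemma dsumZE a x i : (a *: x) i = a *: x i.
Proof. exact: ffunE. Qed.

Let J : finType := {i : I & 'I_(dim (F i))}.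

Fact dsum_vect_iso : Vector.axiom #|J| dsum_sort.
Proof.
pose f x : 'rV[R]_#|J| :=
  \row_(k < #|J|) let p := @enum_val J predT k in v2r (x (tag p)) 0 (tagged p).
exists f.
  by move=> a x y; apply/rowP => k; rewrite !mxE /= dsumDE dsumZE v2r_linear !mxE.
pose g (r : 'rV[R]_#|J|) : dsum_sort :=
  [ffun i => r2v (\row_j r 0 (enum_rank (Tagged (fun i => 'I_(dim (F i))) j : J))) : F i].
exists g => [x|r].
  apply/ffunP => i; rewrite ffunE -[RHS]v2rK; congr r2v.
  by apply/rowP => j; rewrite !mxE enum_rankK.
apply/rowP => k; rewrite !mxE /= ffunE r2vK mxE; congr (r _ _).
by rewrite -[RHS]enum_valK; congr enum_rank; case: (enum_val k).
Qed.

HB.instance Definition _ := Lmodule_hasFinDim.Build R dsum_sort dsum_vect_iso.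

Definition dsum_dot x y : R := \sum_i '[x i, y i].

Fact dsum_dot_bilinear : bilinear_for
  (GRing.Scale.Law.clone _ _ *%R _) (GRing.Scale.Law.clone _ _ (idfun \; *%R) _)
  dsum_dot.
Proof.
split=> [z a x y|z a x y] /=; rewrite /dsum_dot mulr_sumr -big_split /=;
  apply: eq_bigr => i _; rewrite dsumDE dsumZE.
- by rewrite innerDl innerZl.
- by rewrite innerDr innerZr.
Qed.

HB.instance Definition _ :=
  @bilinear_isBilinear.Build R dsum_sort dsum_sort R
    (GRing.Scale.Law.clone _ _ *%R _)
    (GRing.Scale.Law.clone _ _ (idfun \; *%R) _) dsum_dot dsum_dot_bilinear.

Fact dsum_dot_sym x y : dsum_dot x y = (-1) ^+ false * idfun (dsum_dot y x).
Proof.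
by rewrite expr0 mul1r; apply: eq_bigr => i _; rewrite innerC.
Qed.

HB.instance Definition _ :=
  @isHermitianSesquilinear.Build R dsum_sort false idfun dsum_dot dsum_dot_sym.

Fact dsum_dot_gt0 x : x != 0 -> 0 < dsum_dot x x.
Proof.
move=> x0; rewrite lt_neqAle sumr_ge0 ?andbT; last first.
  by move=> i _; exact: inner_ge0.
apply: contraNneq x0 => /esym/eqP; rewrite psumr_eq0 => [/allP H|i _]; last first.
  exact: inner_ge0.
apply/eqP/ffunP => i; rewrite [RHS]ffunE.
have [//|/inner_gt0 H0] := eqVneq (x i) 0.
by have := H i (mem_index_enum i); rewrite (gt_eqF H0).
Qed.

HB.instance Definition _ := @isDotProduct.Build R dsum_sort dsum_dot dsum_dot_gt0.

Definition dsum : ipspace R := @IPSpace R dsum_sort dsum_dot.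

Definition dsum_pr (i : I) : 'Hom(dsum, F i) :=
  linfun (fun x : dsum_sort => x i).

Definition dsum_in (i : I) : 'Hom(F i, dsum) :=
  linfun (fun a : F i => finfun (dfwith (fun j => 0 : F j) i a) : dsum_sort).

Lemma dsum_prE i (x : dsum_sort) : dsum_pr i x = x i.
Proof.
pose h (x : dsum_sort) := x i.
have hlin : linear h by move=> a u v; rewrite /h dsumDE dsumZE.
pose hL := GRing.isLinear.Build _ _ _ _ h hlin.
pose hh : {linear _ -> _} := HB.pack h hL.
exact: (lfunE hh).
Qed.

Lemma dsum_inE i (a : F i) :
  dsum_in i a = finfun (dfwith (fun j => 0 : F j) i a) :> dsum_sort.
Proof.
pose h (a : F i) : dsum_sort := finfun (dfwith (fun j => 0 : F j) i a).
have hlin : linear h.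
  move=> k u v; apply/ffunP => j; rewrite dsumDE dsumZE !ffunE.
  case: (eqVneq i j) => [ij|ij]; last by rewrite !dfwithout // scaler0 addr0.
  by case: j / ij; rewrite !dfwithin.
pose hL := GRing.isLinear.Build _ _ _ _ h hlin.
pose hh : {linear _ -> _} := HB.pack h hL.
exact: (lfunE hh).
Qed.

Lemma dsum_pr_in i (a : F i) : dsum_pr i (dsum_in i a) = a.
Proof. by rewrite dsum_inE dsum_prE ffunE dfwithin. Qed.

Lemma dsum_pr_in0 i j (a : F i) : i != j -> dsum_pr j (dsum_in i a) = 0.
Proof. by move=> ij; rewrite dsum_inE dsum_prE ffunE dfwithout. Qed.

Lemma dsumP (x y : dsum) : (forall i, dsum_pr i x = dsum_pr i y) -> x = y.
Proof. by move=> xy; apply/ffunP => i; have := xy i; rewrite !dsum_prE. Qed.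

Lemma dsum_innerE (x y : dsum) : '[x, y] = \sum_i '[dsum_pr i x, dsum_pr i y].
Proof. by apply: eq_bigr => i _; rewrite !dsum_prE. Qed.

Definition subdsum (T : forall i, {vspace F i}) : {vspace dsum} :=
  (\bigcap_i (dsum_pr i @^-1: T i))%VS.

Lemma memv_subdsum (T : forall i, {vspace F i}) x :
  reflect (forall i, dsum_pr i x \in T i) (x \in subdsum T).
Proof.
apply: (iffP idP) => [xT i|xT].
  rewrite memv_preim; apply: subvP xT.
  exact: (bigcapv_inf i).
by rewrite memvE; apply/subv_bigcapP => i _; rewrite -memvE -memv_preim.
Qed.

End DirectSum.

Record sgraph (V : finType) := SGraph {
  edges : {set {set V}};
  card_edges : forall e : {set V}, e \in edges -> #|e| = 2%N }.

Definition edge (V : finType) (G : sgraph V) := {e : {set V} | e \in edges G}.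

Definition adjacent (V : finType) (G : sgraph V) : rel V :=
  [rel u v | [set u; v]%SET \in edges G].

Definition connected_graph (V : finType) (G : sgraph V) : Prop :=
  (0 < #|V|)%N /\ forall u v, connect (adjacent G) u v.

(* As #|e| = 2, tail e and head e are distinct. *)
Record orientation (V : finType) (G : sgraph V) := Orientation {
  tail : edge G -> V;
  head : edge G -> V;
  tail_head : forall e, val e = [set tail e; head e]%SET }.

Lemma tail_in (V : finType) (G : sgraph V) (o : orientation G) e :
  tail o e \in val e.
Proof. by rewrite (tail_head o) set21. Qed.

Lemma head_in (V : finType) (G : sgraph V) (o : orientation G) e :
  head o e \in val e.
Proof. by rewrite (tail_head o) set22. Qed.

Record stalks (R : realType) (V : finType) (G : sgraph V) := Stalks {
  vstalk : V -> ipspace R;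
  estalk : edge G -> ipspace R }.

Section Sheaf.
Variables (R : realType) (V : finType) (G : sgraph V) (F : stalks R G).

Definition C0 : ipspace R := dsum (vstalk F).
Definition C1 : ipspace R := dsum (estalk F).

Definition restriction_maps :=
  forall (v : V) (e : edge G), v \in val e -> 'Hom(vstalk F v, estalk F e).

Definition coboundary (o : orientation G) (rho : restriction_maps) :
    'Hom(C0, C1) :=
  (\sum_(e : edge G) (dsum_in (estalk F) e \o
     ((rho (head o e) e (head_in o e) \o dsum_pr (vstalk F) (head o e))
      - (rho (tail o e) e (tail_in o e) \o dsum_pr (vstalk F) (tail o e)))))%VF.

Lemma coboundaryE o rho (x : C0) e :
  dsum_pr (estalk F) e (coboundary o rho x) =
    rho (head o e) e (head_in o e) (dsum_pr (vstalk F) (head o e) x)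
    - rho (tail o e) e (tail_in o e) (dsum_pr (vstalk F) (tail o e) x).
Proof.
rewrite sum_lfunE linear_sum (bigD1 e) //= big1 ?addr0; last first.
  by move=> e' ne; rewrite comp_lfunE dsum_pr_in0.
by rewrite comp_lfunE dsum_pr_in add_lfunE opp_lfunE !comp_lfunE.
Qed.

Definition sheaf_laplacian (delta : 'Hom(C0, C1)) : 'End(C0) :=
  (adj delta \o delta)%VF.

Definition block (A : 'Hom(C0, C1)) (v : V) (e : edge G) :
    'Hom(vstalk F v, estalk F e) :=
  (dsum_pr (estalk F) e \o A \o dsum_in (vstalk F) v)%VF.

Definition incidence_space (I : {set V * edge G}) : {vspace 'Hom(C0, C1)} :=
  (\bigcap_(p | p \notin I) lker (linfun (fun A => block A p.1 p.2)))%VS.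

Lemma memv_incidence_space (I : {set V * edge G}) A :
  reflect (forall v e, (v, e) \notin I -> block A v e = 0)
          (A \in incidence_space I).
Proof.
have blockE p : linfun (fun A => block A p.1 p.2) A = block A p.1 p.2.
  pose h A := block A p.1 p.2.
  have hlin : linear h.
    move=> a u v; apply/lfunP => x.
    by rewrite /h /block add_lfunE scale_lfunE !comp_lfunE add_lfunE scale_lfunE linearP.
  pose hL := GRing.isLinear.Build _ _ _ _ h hlin.
  pose hh : {linear _ -> _} := HB.pack h hL.
  exact: (lfunE hh).
apply: (iffP idP) => [AM v e veI|H].
  have : A \in lker (linfun (fun A => block A v e)).
    by apply: subvP AM; exact: (bigcapv_inf (v, e)).
  by rewrite memv_ker (blockE (v, e)) => /eqP.
rewrite memvE; apply/subv_bigcapP => -[v e] veI.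
by rewrite -memvE memv_ker (blockE (v, e)) H.
Qed.

End Sheaf.

Section Dynamics.
Variable R : realType.

(* One-sided at the endpoints of [0, T]. *)
Definition has_deriv_on (V : ipspace R) (T : R) (f : R -> V) (t : R) (d : V) :=
  ipnorm ((s - t)^-1 *: (f s - f t) - d)
    @[s --> within `[0, T] (t^')] --> (0 : R).

Variables (V : finType) (G : sgraph V) (F : stalks R G).

(* y and delta stand for functions on [0, T]; their values elsewhere are
   irrelevant. Opinions in C^0(S) and C^0(Q) are identified with their
   inclusions in C^0. *)
Definition joint_solution (T alpha beta : R) (Q : {vspace C0 F})
    (M : {vspace 'Hom(C0 F, C1 F)}) (u : C0 F)
    (y0 : C0 F) (delta0 : 'Hom(C0 F, C1 F))
    (y : R -> C0 F) (delta : R -> 'Hom(C0 F, C1 F)) : Prop :=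
  let x t := u + y t in
  [/\ y 0 = y0, delta 0 = delta0 &
    forall t, 0 <= t <= T ->
    [/\ y t \in Q,
        has_deriv_on T y t
          (- (alpha *: orthoproj Q (sheaf_laplacian (delta t) (x t)))) &
        @has_deriv_on (frob_ipspace (C0 F) (C1 F)) T delta t
          (- (beta *: frobproj M (outer (delta t (x t)) (x t))))]].

Definition lambda_eff (T : R) (Q : {vspace C0 F})
    (delta : R -> 'Hom(C0 F, C1 F)) (x : R -> C0 F) : R :=
  inf [set ipnorm (orthoproj Q (sheaf_laplacian (delta t) (x t))) ^+ 2
           / ipnorm (delta t (x t)) ^+ 2
      | t in [set t | 0 <= t <= T /\ delta t (x t) != 0]].

Definition mu_eff (T : R) (M : {vspace 'Hom(C0 F, C1 F)})
    (delta : R -> 'Hom(C0 F, C1 F)) (x : R -> C0 F) : R :=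
  inf [set frobnorm (frobproj M (outer (delta t (x t)) (x t))) ^+ 2
           / ipnorm (delta t (x t)) ^+ 2
      | t in [set t | 0 <= t <= T /\ delta t (x t) != 0]].

End Dynamics.

(* Main.v *)
Require Import Defs.
From mathcomp Require Import all_boot all_order all_algebra.
From mathcomp Require Import all_classical all_reals all_analysis.
From mathcomp Require Import ring.

Set Implicit Arguments.
Unset Strict Implicit.
Unset Printing Implicit Defensive.

Import Order.TTheory GRing.Theory Num.Theory.
Import numFieldNormedType.Exports.

Local Open Scope classical_set_scope.
Local Open Scope ring_scope.

(** Let r(t) = |delta(t) x(t)| be the disagreement. The right-hand
    sides of the dynamics are - alpha and - beta times the projected gradients
    of r^2 / 2 in x and in delta, so
<<
      (r^2)' = - 2 (alpha |P_Q(L x)|^2 + beta |Pi_M(delta x x^T)|_F^2)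
            <= - 2 (alpha lam + beta mu) r^2,
>>
    the inequality being the definition of the effective rates as infima
    (at a time where r = 0 it is trivial). Hence r decays at any exponential
    rate k <= alpha lam + beta mu ([disagreement_decay]).

    On the other hand both speeds are controlled by r: projections shrink
    norms, |delta x x^T|_F = r |x| and |delta^T w| <= |delta|_F |w|, whence
    |delta'|_F <= beta Bx r and |x'| <= alpha Bd r. Integrating r with the
    rate k = alpha lam in the first case and k = beta mu in the second gives
<<
      |delta(T) - delta_0|_F <= beta Bx r(0) / (alpha lam),
      |x(T) - x(0)|          <= alpha Bd r(0) / (beta mu)
>>
    ([structural_displacement_le], [opinion_displacement_le]). The thresholds
    rho_- and rho_+ are precisely the values of beta / alpha at which these
    bounds equal eps, and the theorem follows.

    The calculus is done one coordinate at a time: a curve f in an inner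
    product space is differentiated through the real functions <w, f>, so that
    the product rule for delta(t) x(t), Gronwall's inequality and the mean
    value theorem are needed for real functions only. *)

(** * Norms in an inner product space *)

Section InnerNorm.
Variables (R : realType) (V : ipspace R).
Implicit Types x y z : V.

Lemma ipnorm_ge0 x : 0 <= ipnorm x.
Proof. exact: sqrtr_ge0. Qed.

Lemma sqr_ipnorm x : ipnorm x ^+ 2 = '[x, x].
Proof. by rewrite sqr_sqrtr // inner_ge0. Qed.

Lemma ipnorm_eq0 x : (ipnorm x == 0) = (x == 0).
Proof.
have [->|x0] := eqVneq x 0; first by rewrite /ipnorm inner0r sqrtr0 eqxx.
by rewrite gt_eqF // sqrtr_gt0 inner_gt0.
Qed.

Lemma ipnorm_gt0 x : x != 0 -> 0 < ipnorm x.
Proof. by move=> x0; rewrite sqrtr_gt0 inner_gt0. Qed.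

Lemma inner0l x : '[0, x] = 0.
Proof. by rewrite innerC inner0r. Qed.

Lemma ipnormZ a x : ipnorm (a *: x) = `|a| * ipnorm x.
Proof.
by rewrite /ipnorm innerZl innerZr mulrA -expr2 sqrtrM ?sqr_ge0 // sqrtr_sqr.
Qed.

Lemma ipnormN x : ipnorm (- x) = ipnorm x.
Proof. by rewrite -scaleN1r ipnormZ normrN1 mul1r. Qed.

(** For nonzero x and y, expand 0 <= | |y| x - |x| y |^2. *)
Lemma cauchy_schwarz x y : '[x, y] <= ipnorm x * ipnorm y.
Proof.
have [->|/ipnorm_gt0 x0] := eqVneq x 0.
  by rewrite inner0l mulr_ge0 ?ipnorm_ge0.
have [->|/ipnorm_gt0 y0] := eqVneq y 0.
  by rewrite inner0r mulr_ge0 ?ipnorm_ge0.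
have := inner_ge0 (ipnorm y *: x - ipnorm x *: y).
rewrite innerBl ![inner _ (_ - _)]innerC !innerBl !innerZl.
rewrite ![inner _ (_ *: _)]innerC !innerZl -!sqr_ipnorm [inner y x]innerC.
set a := ipnorm x; set b := ipnorm y; set c := inner x y => H.
have : 0 <= (a * b) * (a * b - c) *+ 2.
  by apply: (le_trans H); rewrite le_eqVlt; apply/predU1P; left; ring.
by rewrite pmulrn_lge0 // pmulr_rge0 ?mulr_gt0 // subr_ge0.
Qed.

Lemma normr_inner_le x y : `|'[x, y]| <= ipnorm x * ipnorm y.
Proof.
rewrite ler_norml cauchy_schwarz andbT lerNl -[- _]mulN1r -innerZl.
by rewrite scaleN1r -[ipnorm x]ipnormN cauchy_schwarz.
Qed.

End InnerNorm.

(** * Real functions differentiable inside [0, T] *)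

Section Calculus.
Variables (R : realType) (T : R).
Implicit Types f g : R -> R.

(** Continuity up to the endpoints and differentiability inside: what the mean
    value theorem asks for, stable under sums and products, and free of
    one-sided derivatives. *)
Definition real_deriv_on f f' :=
  {within `[0, T], continuous f} /\
  forall t, t \in `]0, T[ -> is_derive t 1 f (f' t).

Lemma real_deriv_onW f g f' g' : f =1 g -> {in `]0, T[, f' =1 g'} ->
  real_deriv_on f f' -> real_deriv_on g g'.
Proof.
move=> /funext <- E [c d]; split=> // t tT; rewrite -E //; exact: d.
Qed.

Lemma real_deriv_on_cst (a : R) : real_deriv_on (fun=> a) (fun=> 0).
Proof.
split=> [|t _]; last exact: is_derive_cst.
by apply: continuous_subspaceT => x; exact: cst_continuous.
Qed.

Lemma real_deriv_onD f g f' g' : real_deriv_on f f' -> real_deriv_on g g' ->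
  real_deriv_on (fun t => f t + g t) (fun t => f' t + g' t).
Proof.
move=> [cf df] [cg dg]; split=> [|t tT].
  exact: within_continuousD.
exact: is_deriveD (df t tT) (dg t tT).
Qed.

Lemma real_deriv_onM f g f' g' : real_deriv_on f f' -> real_deriv_on g g' ->
  real_deriv_on (fun t => f t * g t) (fun t => f t * g' t + g t * f' t).
Proof.
move=> [cf df] [cg dg]; split=> [|t tT].
  by move=> t; apply: cvgM; [exact: cf|exact: cg].
exact: is_deriveM (df t tT) (dg t tT).
Qed.

Lemma real_deriv_on_sum n (f f' : 'I_n -> R -> R) :
  (forall i, real_deriv_on (f i) (f' i)) ->
  real_deriv_on (fun t => \sum_i f i t) (fun t => \sum_i f' i t).
Proof.
elim: n f f' => [|n IH] f f' H.
  by apply: real_deriv_onW (real_deriv_on_cst 0) => t *; rewrite big_ord0.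
have := real_deriv_onD (H ord0) (IH _ _ (fun i => H (lift ord0 i))).
by apply: real_deriv_onW => t *; rewrite big_ord_recl.
Qed.

Lemma real_deriv_on_expR (c : R) :
  real_deriv_on (fun t => expR (c * t)) (fun t => c * expR (c * t)).
Proof.
have d (t : R) : is_derive t 1 (fun t => expR (c * t)) (c * expR (c * t)).
  rewrite mulrC; apply: (@is_derive1_comp _ expR ( *%R c)).
  by apply: is_derive_eq; rewrite /= ?scaler1.
split=> [|t _]; last exact: d.
apply: derivable_within_continuous => t _.
exact: (@ex_derive _ _ _ _ _ _ _ (d t)).
Qed.

Lemma real_deriv_on_le f f' :
  real_deriv_on f f' -> {in `]0, T[, forall t, f' t <= 0} ->
  forall s t, 0 <= s -> s <= t -> t <= T -> f t <= f s.
Proof.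
move=> [c d] f'0 s t s0 st tT; move: st; rewrite le_eqVlt => /predU1P[->//|st].
have sub r : r \in `]s, t[ -> r \in `]0, T[.
  rewrite !in_itv /= => /andP[sr rt].
  by rewrite (le_lt_trans s0 sr) (lt_le_trans rt tT).
have cst : {within `[s, t], continuous f}.
  apply: continuous_subspaceW c => r /=; rewrite !in_itv /= => /andP[sr rt].
  by rewrite (le_trans s0 sr) (le_trans rt tT).
have [r rst E] := MVT st (fun r rst => d r (sub r rst)) cst.
by rewrite -subr_le0 E mulr_le0_ge0 ?f'0 ?sub // subr_ge0 ltW.
Qed.

(** The derivative of f(t) e^(-c t) is (f'(t) - c f(t)) e^(-c t) <= 0. *)
Lemma gronwall (c : R) (f f' : R -> R) : real_deriv_on f f' ->
  {in `]0, T[, forall t, f' t <= c * f t} ->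
  forall t, 0 <= t <= T -> f t <= f 0 * expR (c * t).
Proof.
move=> Hf f'c t /andP[t0 tT].
have H := real_deriv_onM Hf (real_deriv_on_expR (- c)).
have /(_ _ 0 t) := real_deriv_on_le H; rewrite lexx t0 tT mulr0 expR0 mulr1.
rewrite mulNr expRN ler_pdivrMr ?expR_gt0 //; apply => // s sT.
rewrite mulrA mulrN mulrC -mulrDr pmulr_rle0 ?expR_gt0 //.
by rewrite addrC subr_le0 mulrC f'c.
Qed.

End Calculus.

(** * Curves in an inner product space *)

Section WeakDerivative.
Variables (R : realType) (V : ipspace R) (T : R).

(** In finite dimension this loses nothing, and every rule of calculus becomes
    one on real functions. *)
Definition weak_deriv_on (f f' : R -> V) :=
  forall w : V, real_deriv_on T (fun t => '[w, f t]) (fun t => '[w, f' t]).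

Lemma cvg_difference_quotient (f : R -> V) t d (w : V) : has_deriv_on T f t d ->
  (s - t)^-1 * ('[w, f s] - '[w, f t]) @[s --> within `[0, T] (t^')]
    --> '[w, d].
Proof.
move=> H.
have H0 : ipnorm w * ipnorm ((s - t)^-1 *: (f s - f t) - d)
    @[s --> within `[0, T] (t^')] --> (0 : R).
  by rewrite -[X in _ --> X](mulr0 (ipnorm w)); exact: cvgMl_tmp.
apply/subr_cvg0.
pose err s := ipnorm w * ipnorm ((s - t)^-1 *: (f s - f t) - d).
apply: (@squeeze_cvgr _ _ _ _ (fun s => - err s) err).
- apply: nearW => s; rewrite -ler_norml.
  rewrite [inner w (f s)]innerC [inner w (f t)]innerC -innerBl -innerZl.
  by rewrite [inner w d]innerC -innerBl innerC normr_inner_le.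
- by rewrite -[X in _ --> X]oppr0; exact: cvgN.
- exact: H0.
Qed.

Lemma has_deriv_on_weak (f f' : R -> V) :
  (forall t, 0 <= t <= T -> has_deriv_on T f t (f' t)) -> weak_deriv_on f f'.
Proof.
move=> H w; split=> [|t].
  apply/subspace_continuousP => t; rewrite /= in_itv /= => tT.
  have Q := cvg_difference_quotient (w := w) (H t tT).
  (* For s <> t the function below is the inner product of w and f s, so this
     limit is continuity at t. *)
  have E : (s - t) * ((s - t)^-1 * ('[w, f s] - '[w, f t])) + '[w, f t]
      @[s --> within `[0, T] (t^')] --> '[w, f t].
    rewrite -[X in _ --> X]add0r -[X in X + _](mul0r '[w, f' t]).
    apply: cvgD; last exact: cvg_cst.
    apply: cvgM => //; rewrite -(subrr t); apply: cvgB; last exact: cvg_cst.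
    by apply: cvg_trans (@nbhs_dnbhs _ t); exact: cvg_within.
  move=> A nA; have B := E _ nA.
  have {}B : \forall s \near t, s != t -> s \in `[0, T] ->
    A ((s - t) * ((s - t)^-1 * ('[w, f s] - '[w, f t])) + '[w, f t]).
    exact: B.
  suff : \forall s \near t, s \in `[0, T] -> A '[w, f s] by [].
  near=> s => sT; have [->|st] := eqVneq s t; first exact: nbhs_singleton nA.
  have : A ((s - t) * ((s - t)^-1 * ('[w, f s] - '[w, f t])) + '[w, f t]).
    move: st sT; near: s; exact: B.
  by rewrite mulrA divff ?subr_eq0 // mul1r subrK.
rewrite in_itv /= => /andP[t0 tT].
have tT' : 0 <= t <= T by rewrite !ltW.
have Q := cvg_difference_quotient (w := w) (H t tT').
have {}Q : h^-1 *: (('[w, f (h *: 1 + t)] : R) - '[w, f t]) @[h --> 0^']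
    --> '[w, f' t].
  (* At an interior point t, small increments stay in [0, T], so the restricted
     limit is the full one. *)
  have S : h + t @[h --> (0 : R)^'] --> within `[0, T] (t^').
    have C : h + t @[h --> (0 : R)^'] --> t.
      rewrite -[X in _ --> X]add0r; apply: cvgD; last exact: cvg_cst.
      exact: nbhs_dnbhs.
    have tI : t \in `]0, T[ by rewrite in_itv /= t0 tT.
    move=> A /= nA; have Ch := C _ nA; have CT := C _ (near_in_itvoo tI).
    suff : \forall h \near (0 : R)^', A (h + t) by [].
    near=> h.
    have hT : h + t \in `]0, T[ by near: h; exact: CT.
    have ht : h + t != t.
      by rewrite -subr_eq0 addrK; near: h; exact: nbhs_dnbhs_neq.
    have : h + t != t -> h + t \in `[0, T] -> A (h + t) by near: h; exact: Ch.
    by apply=> //; exact: subset_itv_oo_cc hT.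
  apply: cvg_trans (cvg_comp _ _ S Q) => /=.
  apply: near_eq_cvg; apply: nearW => h /=.
  by rewrite addrK /GRing.scale /= mulr1.
apply: DeriveDef; first by apply/cvg_ex; exists '[w, f' t].
exact: cvg_lim.
Unshelve. all: by end_near. Qed.

End WeakDerivative.

(** * Orthogonal projections and rank-one maps *)

Lemma orthoproj_inner (R : realType) (V : ipspace R) (U : {vspace V}) (x : V) :
  '[x, orthoproj U x] = ipnorm (orthoproj U x) ^+ 2.
Proof.
have [PU /orthocompP/(_ _ PU)] := orthoprojP U x.
by rewrite innerBl sqr_ipnorm => /eqP; rewrite subr_eq0 => /eqP.
Qed.

Lemma ipnorm_orthoproj_le (R : realType) (V : ipspace R)
    (U : {vspace V}) (x : V) :
  ipnorm (orthoproj U x) <= ipnorm x.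
Proof.
have [->|/ipnorm_gt0 P0] := eqVneq (orthoproj U x) 0.
  by rewrite /ipnorm inner0r sqrtr0 sqrtr_ge0.
by rewrite -(ler_pM2r P0) -expr2 -orthoproj_inner cauchy_schwarz.
Qed.

Section Outer.
Variables (R : realType) (V W : ipspace R).
Implicit Types (A : 'Hom(V, W)) (x : V) (w : W).

(** This makes each matrix coefficient of A a Frobenius inner product with A:
    weak differentiability of a curve of maps is differentiability of its
    coefficients, and w x^T is the gradient of <w, A x> in A. *)
Lemma frob_outer A w x : frob (outer w x) A = '[w, A x].
Proof.
have [e eO] := onb_exists (fullv : {vspace V}).
rewrite (frobE _ _ eO) [in RHS](onb_expand eO (memvf x)) linear_sum inner_sumr.
by apply: eq_bigr => i _; rewrite outerE innerZl linearZ innerZr innerC.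
Qed.

Lemma frobnorm_outer w x : frobnorm (outer w x) = ipnorm w * ipnorm x.
Proof.
rewrite /frobnorm {1}/ipnorm /inner /= frob_outer outerE innerZr.
rewrite mulrC -!sqr_ipnorm -exprMn sqrtr_sqr ger0_norm //.
by rewrite mulr_ge0 ?ipnorm_ge0.
Qed.

(** |A^T w|^2 = <w, A A^T w> is the Frobenius product of A with the rank-one map
    w (A^T w)^T, so Cauchy-Schwarz bounds it by |w| |A^T w| |A|_F. *)
Lemma ipnorm_adj_le A w : ipnorm (adj A w) <= frobnorm A * ipnorm w.
Proof.
have [->|/ipnorm_gt0 P0] := eqVneq (adj A w) 0.
  by rewrite {1}/ipnorm inner0r sqrtr0 mulr_ge0 ?ipnorm_ge0.
rewrite -(ler_pM2r P0) -expr2 sqr_ipnorm -adjP innerC -frob_outer.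
have := @cauchy_schwarz R (frob_ipspace V W) (outer w (adj A w)) A.
rewrite -/(frobnorm (outer _ _)) -/(frobnorm A) frobnorm_outer.
by rewrite mulrC mulrA.
Qed.

(** Moving A, resp. x, to the other side of the inner product exhibits the
    gradients A^T A x and (A x) x^T of |A x|^2 / 2. *)
Lemma inner_velocity A (B : 'Hom(V, W)) x (g : V) (a b : R) :
  '[A x, A (- (a *: g)) + (- (b *: B)) x] =
    - (a * '[adj A (A x), g] + b * frob (outer (A x) x) B).
Proof.
rewrite innerDr -!scaleNr linearZ /= scale_lfunE !innerZr frob_outer.
by rewrite innerC adjP innerC !mulNr opprD.
Qed.

End Outer.

(** * Product rules and displacement of a curve *)

Section VectorCalculus.
Variables (R : realType) (V W : ipspace R) (T : R).

Lemma weak_deriv_cstD (a : V) (f f' : R -> V) :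
  weak_deriv_on T f f' -> weak_deriv_on T (fun t => a + f t) f'.
Proof.
move=> H w; have := real_deriv_onD (real_deriv_on_cst T '[w, a]) (H w).
by apply: real_deriv_onW => t *; rewrite ?innerDr ?add0r.
Qed.

Lemma real_deriv_on_inner (f f' g g' : R -> V) :
  weak_deriv_on T f f' -> weak_deriv_on T g g' ->
  real_deriv_on T (fun t => '[f t, g t]) (fun t => '[f t, g' t] + '[g t, f' t]).
Proof.
move=> Hf Hg; have [e eO] := onb_exists (fullv : {vspace V}).
move: (\dim _) e eO => n e eO.
have E (x y : V) : '[x, y] = \sum_(i < n) '[e`_i, x] * '[e`_i, y].
  rewrite {1}(onb_expand eO (memvf x)) inner_suml.
  by apply: eq_bigr => i _; rewrite innerZl.
have := real_deriv_on_sum (fun i : 'I_n =>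
  real_deriv_onM (Hf e`_i) (Hg e`_i)).
by apply: real_deriv_onW => t *; rewrite ?big_split /= -?E.
Qed.

Lemma weak_deriv_apply (A A' : R -> 'Hom(V, W)) (f f' : R -> V) :
  @weak_deriv_on R (frob_ipspace V W) T A A' -> weak_deriv_on T f f' ->
  weak_deriv_on T (fun t => A t (f t)) (fun t => A t (f' t) + A' t (f t)).
Proof.
move=> HA Hf w; have [e eO] := onb_exists (fullv : {vspace V}).
move: (\dim _) e eO => n e eO.
have E (B : 'Hom(V, W)) (x : V) :
    '[w, B x] = \sum_(i < n)
      '[e`_i, x] * @inner R (frob_ipspace V W) (outer w e`_i) B.
  rewrite {1}(onb_expand eO (memvf x)) linear_sum inner_sumr.
  apply: eq_bigr => i _.
  by rewrite linearZ innerZr [in RHS]/inner /= frob_outer.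
have := real_deriv_on_sum (fun i : 'I_n =>
  real_deriv_onM (Hf e`_i) (HA (outer w e`_i))).
apply: real_deriv_onW => t *; rewrite ?E // innerDr !E big_split addrC /=.
by congr (_ + _); apply: eq_bigr => i _; rewrite mulrC.
Qed.

(** Integrate the speed bound in the direction w = f(T) - f(0): the function
    <w, f(t)> + |w| (c / k) e^(-k t) is nonincreasing, and comparing its values
    at 0 and T gives |w|^2 <= |w| c / k. *)
Lemma displacement_le (c k : R) (f f' : R -> V) : 0 <= T -> 0 <= c -> 0 < k ->
  weak_deriv_on T f f' ->
  {in `]0, T[, forall t, ipnorm (f' t) <= c * expR (- k * t)} ->
  ipnorm (f T - f 0) <= c / k.
Proof.
move=> T0 c0 k0 Hf f'c; set w := f T - f 0.
have [->|/ipnorm_gt0 w0] := eqVneq w 0.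
  by rewrite /ipnorm inner0r sqrtr0 divr_ge0 // ltW.
pose b := ipnorm w * (c / k).
have H := real_deriv_onD (Hf w)
  (real_deriv_onM (real_deriv_on_cst T b) (real_deriv_on_expR T (- k))).
have /(_ _ 0 T) := real_deriv_on_le H; rewrite !lexx T0 mulr0 expR0 mulr1.
move=> L; rewrite -(ler_pM2l w0) -/b -expr2 sqr_ipnorm {1}/w innerBl.
rewrite ![inner _ w]innerC.
have {}L : '[w, f T] + b * expR (- k * T) <= '[w, f 0] + b.
  apply: L => // t tT.
  have -> : b * (- k * expR (- k * t)) + expR (- k * t) * 0 =
      - (ipnorm w * (c * expR (- k * t))).
    by rewrite /b; field; rewrite gt_eqF.
  rewrite subr_le0 (le_trans (cauchy_schwarz _ _)) //.
  by rewrite ler_wpM2l ?ipnorm_ge0 ?f'c.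
rewrite lerBlDl; apply: le_trans L; rewrite lerDl.
by rewrite mulr_ge0 ?expR_ge0 // mulr_ge0 ?ipnorm_ge0 // divr_ge0 // ltW.
Qed.

End VectorCalculus.

(** * Projected gradient flow of the disagreement *)

(** The gradient of |D x|^2 / 2 is D^T D x in x and (D x) x^T in D; here x and D
    descend it at the rates a and b inside the subspaces Q and M. *)
Section GradientFlow.
Variables (R : realType) (V W : ipspace R) (T a b : R).
Variables (Q : {vspace V}) (M : {vspace 'Hom(V, W)}).
Variables (x : R -> V) (D : R -> 'Hom(V, W)).

Let gx t := orthoproj Q ((adj (D t) \o D t)%VF (x t)).
Let gD t := frobproj M (outer (D t (x t)) (x t)).
Let r t := ipnorm (D t (x t)).

Hypothesis a_gt0 : 0 < a.
Hypothesis b_gt0 : 0 < b.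
Hypothesis dx : weak_deriv_on T x (fun t => - (a *: gx t)).
Hypothesis dD :
  @weak_deriv_on R (frob_ipspace V W) T D (fun t => - (b *: gD t)).

Lemma real_deriv_on_disagreement :
  real_deriv_on T (fun t => r t ^+ 2)
    (fun t => - 2 * (a * ipnorm (gx t) ^+ 2 + b * frobnorm (gD t) ^+ 2)).
Proof.
have H := weak_deriv_apply dD dx.
apply: real_deriv_onW (real_deriv_on_inner H H) => t *.
  by rewrite sqr_ipnorm.
rewrite -[in LHS]mulr2n inner_velocity /gx /gD comp_lfunE orthoproj_inner.
rewrite -[frob _ _]/(@inner R (frob_ipspace V W) _ _).
rewrite (@orthoproj_inner R (frob_ipspace V W) M) -/(frobnorm _).
by rewrite mulNr mulr_natl mulNrn.
Qed.

Variables (l m : R).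
Hypothesis l_lower :
  forall t, 0 <= t <= T -> l * r t ^+ 2 <= ipnorm (gx t) ^+ 2.
Hypothesis m_lower :
  forall t, 0 <= t <= T -> m * r t ^+ 2 <= frobnorm (gD t) ^+ 2.

(** Gronwall's inequality is applied to r^2 and not to r, which need not be
    differentiable where it vanishes. *)
Lemma disagreement_decay k : k <= a * l + b * m ->
  forall t, 0 <= t <= T -> r t <= r 0 * expR (- k * t).
Proof.
move=> kle t tT.
have E : expR (- k * t) ^+ 2 = expR (- 2 * k * t).
  by rewrite expr2 -expRD; congr expR; ring.
rewrite -(ler_sqr (x := r t)) ?nnegrE ?mulr_ge0 ?expR_ge0 ?ipnorm_ge0 //.
rewrite exprMn E; apply: (gronwall real_deriv_on_disagreement) => // s.
rewrite in_itv /= => /andP[s0 sT].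
have sT' : 0 <= s <= T by rewrite !ltW.
rewrite -mulrA ler_nM2l ?oppr_lt0 //.
apply: le_trans (_ : (a * l + b * m) * r s ^+ 2 <= _).
  by rewrite ler_wpM2r // sqr_ge0.
by rewrite mulrDl -!mulrA lerD // ler_pM2l ?l_lower ?m_lower.
Qed.

Hypothesis T_ge0 : 0 <= T.

(** The speed of D is at most b |(D x) x^T|_F <= b B r, and r decays at least at
    the rate a l. *)
Lemma structural_displacement_le B : 0 < l -> 0 <= m -> 0 <= B ->
  (forall t, 0 <= t <= T -> ipnorm (x t) <= B) ->
  frobnorm (D T - D 0) <= b * B * r 0 / (a * l).
Proof.
move=> l0 m0 B0 xB.
have r0 t : 0 <= r t by exact: ipnorm_ge0.
apply: (displacement_le T_ge0 _ _ dD).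
- by rewrite !mulr_ge0 // ltW.
- exact: mulr_gt0.
move=> t; rewrite in_itv /= => /andP[t0 tT].
have tT' : 0 <= t <= T by rewrite !ltW.
rewrite ipnormN ipnormZ gtr0_norm // -!mulrA ler_pM2l //.
rewrite (le_trans (ipnorm_orthoproj_le _ _)) // -/(frobnorm _).
rewrite frobnorm_outer mulrC.
by rewrite ler_pM ?ipnorm_ge0 ?xB // disagreement_decay // lerDl mulr_ge0 // ltW.
Qed.

(** The speed of x is at most a |D^T D x| <= a B r, and r decays at least at the
    rate b m. *)
Lemma opinion_displacement_le B : 0 <= l -> 0 < m -> 0 <= B ->
  (forall t, 0 <= t <= T -> frobnorm (D t) <= B) ->
  ipnorm (x T - x 0) <= a * B * r 0 / (b * m).
Proof.
move=> l0 m0 B0 DB.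
have r0 t : 0 <= r t by exact: ipnorm_ge0.
apply: (displacement_le T_ge0 _ _ dx).
- by rewrite !mulr_ge0 // ltW.
- exact: mulr_gt0.
move=> t; rewrite in_itv /= => /andP[t0 tT].
have tT' : 0 <= t <= T by rewrite !ltW.
rewrite ipnormN ipnormZ gtr0_norm // -!mulrA ler_pM2l //.
rewrite (le_trans (ipnorm_orthoproj_le _ _)) // comp_lfunE.
rewrite (le_trans (ipnorm_adj_le _ _)) //.
by rewrite ler_pM ?ipnorm_ge0 ?DB // disagreement_decay // lerDr mulr_ge0 // ltW.
Qed.

End GradientFlow.

(** * The displacement bounds and the three regimes *)

(** The form in which the effective rates enter: multiplied by the denominator,
    the bound also holds at the indices left out of the infimum because their
    denominator vanishes. *)
Lemma inf_ratio_le (R : realType) (X : Type) (A : set X) (p q : X -> R) i :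
  (forall j, 0 <= p j) -> (forall j, 0 <= q j) -> (q i != 0 -> A i) ->
  inf [set p j / q j | j in A] * q i <= p i.
Proof.
move=> p0 q0 Ai; have [->|qi] := eqVneq (q i) 0; first by rewrite mulr0.
have qi0 : 0 < q i by rewrite lt_neqAle eq_sym qi q0.
rewrite -ler_pdivlMr //; apply: ge_inf; last by exists i => //; exact: Ai.
by exists 0 => _ [j _ <-]; rewrite divr_ge0.
Qed.

Theorem corollary6p5 (R : realType) (V : finType) (G : sgraph V)
    (F : stalks R G) (o : orientation G)
    (U : {set V}) (S : forall v : V, {vspace vstalk F v})
    (I : {set V * edge G})
    (T alpha beta Bx Bd eps : R)
    (u y0 : C0 F) (delta0 : 'Hom(C0 F, C1 F))
    (y : R -> C0 F) (rho : R -> restriction_maps F) :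
  let Q : {vspace C0 F} := subdsum (fun v => orthocomp (S v)) in
  let M := incidence_space F I in
  let delta t := coboundary o (rho t) in
  let x t := u + y t in
  let x0 := u + y0 in
  let lam := lambda_eff T Q delta x in
  let mu := mu_eff T M delta x in
  let rho_minus := eps * lam / (Bx * ipnorm (delta0 x0)) in
  let rho_plus := Bd * ipnorm (delta0 x0) / (eps * mu) in
  connected_graph G ->
  (forall v, v \notin U -> S v = 0%VS) ->
  (forall v e, (v, e) \in I -> v \in val e) ->
  u \in (subdsum S : {vspace C0 F}) ->
  0 <= T -> 0 < alpha -> 0 < beta ->
  joint_solution T alpha beta Q M u y0 delta0 y delta ->
  delta0 x0 != 0 ->
  0 < Bx ->
  (ereal_sup [set (ipnorm (x t))%:E | t in `[0%R, T]%classic] <= Bx%:E)%E ->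
  0 < Bd ->
  (ereal_sup [set (frobnorm (delta t))%:E | t in `[0%R, T]%classic] <= Bd%:E)%E ->
  0 < lam -> 0 < mu ->
  0 < eps ->
  [/\ beta / alpha <= rho_minus -> frobnorm (delta T - delta0) <= eps,
      rho_plus <= beta / alpha -> ipnorm (x T - x 0) <= eps,
      eps ^+ 2 < Bx * Bd * ipnorm (delta0 x0) ^+ 2 / (lam * mu) ->
        rho_minus < rho_plus &
      rho_minus < beta / alpha < rho_plus ->
        let structural_bound :=
          beta * Bx * ipnorm (delta0 x0) / (alpha * lam) in
        let opinion_bound :=
          alpha * Bd * ipnorm (delta0 x0) / (beta * mu) in
        [/\ frobnorm (delta T - delta0) <= structural_bound,
            ipnorm (x T - x 0) <= opinion_bound,
            eps < structural_bound & eps < opinion_bound]].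
Proof.
move=> Q M delta x x0 lam mu rho_minus rho_plus _ _ _ _ T0 a0 b0.
move=> [yE dE sol] nz Bx0 xBx Bd0 dBd lam0 mu0 eps0.
have dx : weak_deriv_on T x (fun t =>
    - (alpha *: orthoproj Q (sheaf_laplacian (delta t) (x t)))).
  by apply/weak_deriv_cstD/has_deriv_on_weak => t /sol[].
have dD : @weak_deriv_on R (frob_ipspace (C0 F) (C1 F)) T delta (fun t =>
    - (beta *: frobproj M (outer (delta t (x t)) (x t)))).
  by apply: has_deriv_on_weak => t /sol[].
have lamP t : 0 <= t <= T -> lam * ipnorm (delta t (x t)) ^+ 2 <=
    ipnorm (orthoproj Q (sheaf_laplacian (delta t) (x t))) ^+ 2.
  move=> tT; rewrite /lam /lambda_eff; apply: inf_ratio_le => [j|j|];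
    rewrite ?sqr_ge0 //.
  by rewrite sqrf_eq0 ipnorm_eq0.
have muP t : 0 <= t <= T -> mu * ipnorm (delta t (x t)) ^+ 2 <=
    frobnorm (frobproj M (outer (delta t (x t)) (x t))) ^+ 2.
  move=> tT; rewrite /mu /mu_eff; apply: inf_ratio_le => [j|j|];
    rewrite ?sqr_ge0 //.
  by rewrite sqrf_eq0 ipnorm_eq0.
have xB t : 0 <= t <= T -> ipnorm (x t) <= Bx.
  move=> tT; rewrite -lee_fin; apply: le_trans xBx; apply: ereal_sup_ubound.
  by exists t => //=; rewrite in_itv.
have dB t : 0 <= t <= T -> frobnorm (delta t) <= Bd.
  move=> tT; rewrite -lee_fin; apply: le_trans dBd; apply: ereal_sup_ubound.
  by exists t => //=; rewrite in_itv.
have := structural_displacement_le a0 b0 dx dD lamP muP T0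
  lam0 (ltW mu0) (ltW Bx0) xB.
have := opinion_displacement_le a0 b0 dx dD lamP muP T0
  (ltW lam0) mu0 (ltW Bd0) dB.
rewrite /x yE dE -/x -/x0 => op st.
have n0 := ipnorm_gt0 nz.
rewrite /rho_minus /rho_plus; move: (ipnorm (delta0 x0)) n0 op st => n n0 op st.
(* The thresholds for beta / alpha are where the displacement bounds equal eps;
   negating these equivalences settles the intermediate regime. *)
have Emin : (beta / alpha <= eps * lam / (Bx * n)) =
    (beta * Bx * n / (alpha * lam) <= eps).
  rewrite ler_pdivrMr // mulrAC ler_pdivlMr ?mulr_gt0 //.
  rewrite [RHS]ler_pdivrMr ?mulr_gt0 //.
  by congr (_ <= _); ring.
have Eplus : (Bd * n / (eps * mu) <= beta / alpha) =
    (alpha * Bd * n / (beta * mu) <= eps).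
  rewrite ler_pdivrMr ?mulr_gt0 // mulrAC ler_pdivlMr //.
  rewrite [RHS]ler_pdivrMr ?mulr_gt0 //.
  by congr (_ <= _); ring.
split=> [||H|/andP[]].
- by rewrite Emin; exact: le_trans.
- by rewrite Eplus; exact: le_trans.
- rewrite ltr_pdivrMr ?mulr_gt0 // mulrAC ltr_pdivlMr ?mulr_gt0 //.
  move: H; rewrite ltr_pdivlMr ?mulr_gt0 // => H.
  rewrite [ltLHS](_ : _ = eps ^+ 2 * (lam * mu)); last by ring.
  by rewrite [ltRHS](_ : _ = Bx * Bd * n ^+ 2) //; ring.
- by rewrite !ltNge Emin Eplus -!ltNge.
Qed.
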